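(* Let $n$ be a positive integer, $k\in\{1,\dots,n\}\setminus\{1\}$, and let $A,B\colon[0,1]^n\to[0,1]$ be semicopulas with $A\le B$. Assume that $L_k^{(A,B)}(\mathbf R)\ge 0$ for all $\mathbf R\in\mathcal R_k([0,1]^n)$. Then the following are equivalent: (i) for all $\mathbf x\in[0,1]^n$: $P_{\mathrm M,k}^{(A,B)}(\mathbf x)=B(\mathbf x)-A(\mathbf x)$; (ii) for all $\mathbf x\in[0,1]^n$: $$A(\mathbf x)=\inf\{C(\mathbf x)\mid C\colon[0,1]^n\to[0,1],\ A\le C\le B,\ C\text{ is a $k$-increasing semicopula}\}.$$ Moreover, each of the conditions (i) and (ii) implies that $A$ is a quasi-copula.
   Context: Write $\mathbb I=[0,1]$; $\le$ between functions is the pointwise order, and ''increasing'' means non-decreasing. Boxes. For $\mathbf x,\mathbf y\in\mathbb I^n$, the product $R=[\mathbf x,\mathbf y]=\prod_{i=1}^n[x_i,y_i]$ is a $k$-box if $x_i<y_i$ for exactly $k$ indices $i$ and $x_i=y_i$ for the remaining $n-k$ indices. Its vertices are $\operatorname{ver}R=\prod_{i=1}^n\{x_i,y_i\}$. The sign of a vertex $\mathbf v$ is $\operatorname{sign}_R(\mathbf v)=(-1)^{m-(n-k)}$, where $m=|\{i: v_i=x_i\}|$. The multiplicity of $\mathbf u\in\mathbb I^n$ with respect to $R$ is $m_R(\mathbf u)=\operatorname{sign}_R(\mathbf u)$ if $\mathbf u\in\operatorname{ver}R$ and $0$ otherwise. $\mathcal R_k(\mathbb I^n)$ is the set of formal finite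 disjoint unions $\mathbf R=\bigsqcup_{j=1}^s R_j$ of $k$-boxes with vertices in $\mathbb I^n$, i.e. finite families (multisets) of $k$-boxes, where repetitions and overlaps are allowed; $m_{\mathbf R}(\mathbf u)=\sum_{j=1}^s m_{R_j}(\mathbf u)$. For functions $A\le B$ on $\mathbb I^n$, $$L_k^{(A,B)}(\mathbf R)=\sum_{\mathbf y:\,m_{\mathbf R}(\mathbf y)>0}m_{\mathbf R}(\mathbf y)B(\mathbf y)+\sum_{\mathbf y:\,m_{\mathbf R}(\mathbf y)<0}m_{\mathbf R}(\mathbf y)A(\mathbf y),\qquad P_{\mathrm M,k}^{(A,B)}(\mathbf x)=\inf_{\substack{\mathbf R\in\mathcal R_k(\mathbb I^n)\\ m_{\mathbf R}(\mathbf x)>0}}\frac{L_k^{(A,B)}(\mathbf R)}{|m_{\mathbf R}(\mathbf x)|},$$ with the convention that the infimum of the empty set in the definition of $P_{\mathrm M,k}^{(A,B)}$ equals $0$. Functions. $f\colon\mathbb I^n\to\mathbb I$ is $k$-increasing if $\sum_{\mathbf v\in\operatorname{ver}R}\operatorname{sign}_R(\mathbf v)f(\mathbf v)\ge0$ for every $k$-box $R$ in $\mathbb I^n$ ($1$-increasing means increasing in each variable); grounded if $f(\mathbf x)=0$ whenever some $x_i=0$; it has uniform marginals if $f(1,\dots,1,x_i,1,\dots,1)=x_i$ for all $x_i\in\mathbb I$ and all $i$. A semicopula is a grounded, $1$-increasing function $\mathbb I^n\to\mathbb I$ with uniform marginals. A quasi-copula is a $1$-Lipschitz semicopula (i.e.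 $|f(\mathbf x)-f(\mathbf y)|\le\sum_i|x_i-y_i|$). *)

(* Defs.v *)
From HB Require Import structures.
From mathcomp Require Import all_boot all_order all_algebra.
From mathcomp Require Import all_classical all_reals all_analysis.
Set Implicit Arguments.
Unset Strict Implicit.
Unset Printing Implicit Defensive.
Import Order.TTheory GRing.Theory Num.Theory.
Local Open Scope classical_set_scope.
Local Open Scope ring_scope.

(* A function on I^n = [0,1]^n is represented by a total function on 'rV[R]_n;
   only its values on [cube] matter, and every condition below on such a
   function is relativized to [cube]. *)
Definition cube (R : realType) (n : nat) : set 'rV[R]_n :=
  [set x | forall i, 0 <= x 0 i <= 1].

Definition fle (R : realType) (n : nat) (f g : 'rV[R]_n -> R) : Prop :=
  forall x, cube x -> f x <= g x.

(* The pair (x, y) stands for the box [x, y]; it is a genuine box only under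
   [is_kbox]. *)
Definition box (R : realType) (n : nat) : Type := ('rV[R]_n * 'rV[R]_n)%type.

Definition box_dim (R : realType) (n : nat) (b : box R n) : nat :=
  #|[pred i : 'I_n | (b.1 0 i < b.2 0 i)%R]|.

Definition is_kbox (R : realType) (n k : nat) (b : box R n) : Prop :=
  [/\ cube b.1, cube b.2, (forall i, b.1 0 i <= b.2 0 i) & box_dim b = k].

Definition is_vertex (R : realType) (n : nat) (b : box R n) (v : 'rV[R]_n) : bool :=
  [forall i, (v 0 i == b.1 0 i) || (v 0 i == b.2 0 i)].

Definition ver (R : realType) (n : nat) (b : box R n) : set 'rV[R]_n :=
  [set v | is_vertex b v].

(* At a vertex the exponent is a genuine (untruncated) difference: each of the
   n - k degenerate indices of a k-box has v_i = x_i. *)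
Definition box_sign (R : realType) (n : nat) (b : box R n) (v : 'rV[R]_n) : int :=
  (-1) ^+ (#|[pred i : 'I_n | (v 0 i == b.1 0 i)%R]| - (n - box_dim b))%N.

Definition box_mult (R : realType) (n : nat) (b : box R n) (u : 'rV[R]_n) : int :=
  if is_vertex b u then box_sign b u else 0.

(* Finite multisets of k-boxes are represented by sequences; [mult] and [L]
   do not depend on the order. *)
Definition kbox_unions (R : realType) (n k : nat) : set (seq (box R n)) :=
  [set bs | forall b, b \in bs -> is_kbox k b].

Definition mult (R : realType) (n : nat) (bs : seq (box R n)) (u : 'rV[R]_n) : int :=
  \sum_(b <- bs) box_mult b u.

(* The sums range over finite sets, since [mult bs] vanishes outside the
   vertices of the boxes in [bs]. *)
Definition L (R : realType) (n : nat) (A B : 'rV[R]_n -> R)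
    (bs : seq (box R n)) : R :=
  \sum_(y \in [set y | (0 < mult bs y)%R]) (mult bs y)%:~R * B y +
  \sum_(y \in [set y | (mult bs y < 0)%R]) (mult bs y)%:~R * A y.

Definition PM_ratios (R : realType) (n k : nat) (A B : 'rV[R]_n -> R)
    (x : 'rV[R]_n) : set (\bar R) :=
  [set (L A B bs / `|mult bs x|%:~R)%:E |
     bs in [set bs | kbox_unions k bs /\ (0 < mult bs x)%R]].

(* Extended-real valued, because the infimum can be -oo when L takes negative
   values; the infimum of the empty set is 0 here by convention. *)
Definition PM (R : realType) (n k : nat) (A B : 'rV[R]_n -> R)
    (x : 'rV[R]_n) : \bar R :=
  if `[< PM_ratios k A B x = set0 >] then 0%E
  else ereal_inf (PM_ratios k A B x).

Definition unit_valued (R : realType) (n : nat) (f : 'rV[R]_n -> R) : Prop :=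
  forall x, cube x -> 0 <= f x <= 1.

Definition k_increasing (R : realType) (n k : nat) (f : 'rV[R]_n -> R) : Prop :=
  forall b : box R n, is_kbox k b ->
    0 <= \sum_(v \in ver b) (box_sign b v)%:~R * f v.

Definition grounded (R : realType) (n : nat) (f : 'rV[R]_n -> R) : Prop :=
  forall x, cube x -> (exists i, x 0 i = 0) -> f x = 0.

Definition uniform_marginals (R : realType) (n : nat) (f : 'rV[R]_n -> R) : Prop :=
  forall (i : 'I_n) (t : R), 0 <= t <= 1 ->
    f (\row_j (if j == i then t else 1)) = t.

Definition semicopula (R : realType) (n : nat) (f : 'rV[R]_n -> R) : Prop :=
  [/\ unit_valued f, grounded f, k_increasing 1 f & uniform_marginals f].

Definition one_lipschitz (R : realType) (n : nat) (f : 'rV[R]_n -> R) : Prop :=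
  forall x y, cube x -> cube y -> `|f x - f y| <= \sum_i `|x 0 i - y 0 i|.

Definition quasicopula (R : realType) (n : nat) (f : 'rV[R]_n -> R) : Prop :=
  semicopula f /\ one_lipschitz f.

Definition between_kinc_semicopulas (R : realType) (n k : nat)
    (A B : 'rV[R]_n -> R) : set ('rV[R]_n -> R) :=
  [set C | [/\ fle A C, fle C B, k_increasing k C & semicopula C]].

(* Main.v *)
(** The analytic core is a feasibility principle: if [L A B] is nonnegative on
    all unions of k-boxes, there is a k-increasing [C] with [A <= C <= B].
    Zorn's lemma gives a minimal upper bound [C] keeping [L A C >= 0].  By
    minimality, each point [x] with [A x < C x] has unions [r] with
    [mult r x > 0] and [L A C r] arbitrarily small relative to [mult r x].
    Adding suitable multiples of such unions cancels any negative
    multiplicity, so the lower function may be replaced by [C] itself at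
    finitely many points, and [L C C >= 0] says that [C] is k-increasing.

    Condition (i) says exactly that [B] may be lowered to [A x] at a single
    point [x] without spoiling [L >= 0], so feasibility yields a [C] with
    [C x = A x].  As [C] is grounded and [k >= 2], it is also 1- and
    2-increasing, hence a 1-Lipschitz semicopula; so is an infimum of such [C].
    Conversely, (ii) gives [PM >= B - A] by evaluating the nonnegative volume
    of [C] on a union, and [PM <= B - A] by explicit thin boxes, along which
    the Lipschitz continuity of [A] is used. *)
Require Import Defs.
From HB Require Import structures.
From mathcomp Require Import all_boot all_order all_algebra.
From mathcomp Require Import all_classical all_reals all_analysis.
From mathcomp Require Import lra.
Set Implicit Arguments.
Unset Strict Implicit.
Unset Printing Implicit Defensive.
Import Order.TTheory GRing.Theory Num.Theory.
Local Open Scope classical_set_scope.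
Local Open Scope ring_scope.

(** * Feasibility for finitely supported integer weights on a set *)

Section Feasibility.
Variables (R : realType) (T : choiceType).
Implicit Types (a b : R) (m r : T -> int) (A B C : T -> R).

(** For [a <= b] this is the maximum of [z * c] over [c] in [[a, b]], the support function of that
    interval. *)
Definition weight a b (z : int) : R := z%:~R * (if 0 <= z then b else a).

Lemma weight0 a b : weight a b 0 = 0.
Proof. by rewrite /weight mul0r. Qed.

Lemma weight_diag a (z : int) : weight a a z = z%:~R * a.
Proof. by rewrite /weight if_same. Qed.

Lemma weight_ge a b c (z : int) : a <= c <= b -> z%:~R * c <= weight a b z.
Proof.
move=> /andP[ac cb]; rewrite /weight; case: ifPn => z0.
  by rewrite ler_wpM2l// ler0z.
by rewrite ler_wnM2l// lerz0; move: z0; rewrite -ltNge => /ltW.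
Qed.

Lemma weight_le a b a' b' (z : int) : a' <= a -> b <= b' ->
  weight a b z <= weight a' b' z.
Proof.
move=> aa bb; rewrite /weight; case: ifPn => z0.
  by rewrite ler_wpM2l// ler0z.
by rewrite ler_wnM2l// lerz0; move: z0; rewrite -ltNge => /ltW.
Qed.

(** Sublinearity of a support function: the endpoint attaining the left side is admissible in both
    terms on the right. *)
Lemma weight_comb a b (p q : nat) (z w : int) : a <= b ->
  weight a b (p%:Z * z + q%:Z * w) <=
  p%:R * weight a b z + q%:R * weight a b w.
Proof.
move=> ab; rewrite {1}/weight; set c := if _ then b else a.
have cab : a <= c <= b by rewrite /c; case: ifP; rewrite lexx ab.
rewrite rmorphD !rmorphM /= mulrDl -!mulrA -!pmulrn.
by rewrite lerD// ler_wpM2l ?ler0n// weight_ge.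
Qed.

(** This is [L] as a function of multiplicities alone, so that unions can be added and scaled; see
    [L_total]. *)
Definition total A B m : R := \sum_(y \in setT) weight (A y) (B y) (m y).

Definition vanishes_off (s : seq T) m := forall y, y \notin s -> m y = 0.

Lemma totalE A B m s : vanishes_off s m ->
  total A B m = \sum_(y <- undup s) weight (A y) (B y) (m y).
Proof.
move=> ms; rewrite /total [RHS]fsbig_seq ?undup_uniq//.
apply: esym; apply: fsbig_widen => //.
by move=> y [_ /= /negP]; rewrite mem_undup => /ms /= ->; rewrite weight0.
Qed.

Lemma eq_total A B A' B' m :
  (forall y, m y != 0 -> A y = A' y) -> (forall y, m y != 0 -> B y = B' y) ->
  total A B m = total A' B' m.
Proof.
move=> hA hB; apply: eq_fsbigr => y _.
by have [->|m0] := eqVneq (m y) 0; rewrite ?weight0// hA// hB.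
Qed.

Lemma cat_vanishes s s' m r : vanishes_off s m -> vanishes_off s' r ->
  vanishes_off (s ++ s') m /\ vanishes_off (s ++ s') r.
Proof.
by move=> hm hr; split=> y; rewrite mem_cat negb_or => /andP[/hm + /hr].
Qed.

Lemma total_comb A B (p q : nat) m r s s' :
  vanishes_off s m -> vanishes_off s' r -> (forall y, A y <= B y) ->
  total A B (fun y => p%:Z * m y + q%:Z * r y) <=
  p%:R * total A B m + q%:R * total A B r.
Proof.
move=> hm hr AB; have {hm hr}[hm hr] := cat_vanishes hm hr.
rewrite (totalE A B hm) (totalE A B hr) (@totalE _ _ _ (s ++ s')); last first.
  by move=> y ys; rewrite hm// hr// !mulr0.
rewrite !mulr_sumr -big_split/=; apply: ler_sum => y _; exact: weight_comb.
Qed.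

Lemma total_le A B A' B' m s : vanishes_off s m ->
  (forall y, m y != 0 -> A' y <= A y /\ B y <= B' y) ->
  total A B m <= total A' B' m.
Proof.
move=> hm hAB; rewrite !(totalE _ _ hm); apply: ler_sum => y _.
have [->|/hAB[hA hB]] := eqVneq (m y) 0; first by rewrite !weight0.
exact: weight_le.
Qed.

(** Only the term at [x] changes, and it reads the upper function only when [m x] is nonnegative. *)
Lemma total_shift_upper A B m s x (d : R) : vanishes_off s m ->
  total A (fun y => if y == x then B y - d else B y) m =
  total A B m - (if 0 <= m x then (m x)%:~R * d else 0).
Proof.
move=> hm; have {}hm : vanishes_off (x :: s) m.
  by move=> y; rewrite inE negb_or => /andP[_ /hm].
rewrite !(totalE _ _ hm).
have xs : x \in undup (x :: s) by rewrite mem_undup mem_head.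
have us := undup_uniq (x :: s).
rewrite (bigD1_seq x xs us)/= eqxx [in RHS](bigD1_seq x xs us)/=.
rewrite [RHS]addrAC; congr (_ + _); last by apply: eq_bigr => y /negPf ->.
by rewrite /weight; case: ifP => _; rewrite ?subr0// mulrBr.
Qed.

(** Stands for the multiplicity functions of unions of k-boxes; disjoint union becomes addition. *)
Variable K : set (T -> int).
Hypothesis K_add : forall m r, K m -> K r -> K (fun y => m y + r y).
Hypothesis K_fin : forall m, K m -> exists s, vanishes_off s m.

Lemma K_comb m r (p q : nat) : K m -> K r ->
  K (fun y => p.+1%:Z * m y + q.+1%:Z * r y).
Proof.
have mul u : K u -> forall p, K (fun y => p.+1%:Z * u y).
  move=> Ku; elim=> [|j IH].
    by under eq_fun do rewrite mul1r.
  under eq_fun do rewrite -addn1 PoszD mulrDl mul1r.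
  exact: K_add.
by move=> Km Kr; apply: K_add; exact: mul.
Qed.

Definition nonneg_on A B := forall m, K m -> 0 <= total A B m.

(** In a chain the smaller of two members inherits both estimates, so one member is close to the
    infimum at finitely many points at once. *)
Lemma chain_eps (F : set (T -> R)) (g : T -> R) (s : seq T) (e : R) :
  0 < e -> F !=set0 ->
  total_on F (fun f f' => forall y, f' y <= f y) ->
  (forall f y, F f -> g y <= f y) ->
  (forall y e, 0 < e -> exists2 f, F f & f y < g y + e) ->
  exists2 f, F f & forall y, y \in s -> f y <= g y + e.
Proof.
move=> e0 [f0 Ff0] tot gf fg; elim: s => [|x s [f Ff IH]]; first by exists f0.
have [f' Ff' f'x] := fg x e e0.
have [le|le] := tot _ _ Ff Ff'.
  exists f' => // y; rewrite inE => /predU1P[->|ys]; first exact: ltW.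
  exact: le_trans (le y) (IH _ ys).
exists f => // y; rewrite inE => /predU1P[->|ys]; last exact: IH.
exact: le_trans (le x) (ltW _).
Qed.

Lemma minimal_upper A B : (forall y, A y <= B y) -> nonneg_on A B ->
  exists C, [/\ forall y, A y <= C y <= B y, nonneg_on A C &
    forall D, (forall y, A y <= D y <= C y) -> nonneg_on A D -> D = C].
Proof.
move=> AB nnB.
pose P C := (forall y, A y <= C y <= B y) /\ nonneg_on A C.
have PB : P B by split=> // y; rewrite AB lexx.
(* The order is reversed: a maximal element for [rel] is a minimal upper function. *)
pose rel (f f' : {C | P C}) := `[< forall y, sval f' y <= sval f y >].
have [||||C Cmax] := @Zorn {C | P C} rel.
- by move=> f; apply/asboolP.
- move=> f g h /asboolP fg /asboolP gh; apply/asboolP => y.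
  exact: le_trans (gh y) (fg y).
- move=> [f Pf] [g Pg] /asboolP fg /asboolP gf; apply: eq_exist.
  by apply/funext => y; apply/le_anti; rewrite [_ <= _]gf [_ <= _]fg.
- move=> F totF.
  have [[[f0 Pf0] Ff0]|Fempty] := pselect (F !=set0); last first.
    by exists (exist _ B PB) => f Ff; case: Fempty; exists f.
  pose G := [set sval f | f in F].
  pose V y := [set f y | f in G].
  have G0 : G f0 by exists (exist _ f0 Pf0).
  have GP f : G f -> P f by case=> [[g Pg] _ <-].
  have Vlb y : lbound (V y) (A y).
    by move=> _ [f /GP[+ _] <-] => /(_ y)/andP[].
  have Vinf y : has_inf (V y).
    by split; [exists (f0 y); exists f0 | exists (A y); exact: Vlb].
  pose g y := inf (V y).
  have gle f y : G f -> g y <= f y.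
    by move=> Gf; apply: ge_inf; [exists (A y); exact: Vlb | exists f].
  have Ag y : A y <= g y.
    by apply: lb_le_inf; [exists (f0 y); exists f0 | exact: Vlb].
  have Pg : P g.
    split=> [y|m Km].
      rewrite Ag/= (le_trans (gle _ _ G0))//.
      by have /andP[] := Pf0.1 y.
    have [s hs] := K_fin Km.
    pose c := \sum_(y <- undup s) `|(m y)%:~R : R|.
    have c0 : 0 <= c by apply: sumr_ge0 => y _.
    suff H e : 0 < e -> 0 <= total A g m + e * c.
      rewrite leNgt; apply/negP => neg.
      (* With this [e] the error [e * c] is at most half of [- total A g m], so the total cannot be
         negative; [c + 1] keeps the denominator positive. *)
      have := H (- total A g m / (c + 1) / 2).
      have c1 : 0 < c + 1 by rewrite ltr_wpDl.
      rewrite !divr_gt0 ?oppr_gt0// => /(_ isT).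
      apply/negP; rewrite -ltNge.
      set t := total A g m in neg *.
      have : - t / (c + 1) / 2 * c <= - t / 2.
        rewrite mulrAC ler_pM2r ?invr_gt0// -mulrA.
        apply: ler_piMr; first by rewrite oppr_ge0 ltW.
        by rewrite mulrC ler_pdivrMr// mul1r lerDl.
      by lra.
    move=> e0.
    have [f Gf fle] : exists2 f, G f & forall y, y \in s -> f y <= g y + e.
      apply: chain_eps => //; first by exists f0.
      - move=> _ _ [u Fu <-] [v Fv <-].
        by have [/asboolP uv|/asboolP vu] := totF _ _ Fu Fv; [left|right].
      - move=> y e' e'0.
        have [_ [f Gf <-] lt] := inf_adherent e'0 (Vinf y).
        by exists f.
    have [_ /(_ _ Km) tf] := GP _ Gf; apply: le_trans tf _.
    rewrite !(totalE _ _ hs) /c mulr_sumr -big_split/=.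
    rewrite [leLHS]big_seq_cond [leRHS]big_seq_cond.
    apply: ler_sum => y /[!mem_undup] /[!andbT] ys.
    rewrite /weight; case: ifPn => m0; last by rewrite lerDl mulr_ge0// ltW.
    rewrite ger0_norm ?ler0z// [e * _]mulrC -mulrDr ler_wpM2l ?ler0z//.
    exact: fle.
  exists (exist _ g Pg) => f Ff; apply/asboolP => y /=.
  by apply: gle; exists f.
have [CAB nnC] := svalP C.
exists (sval C); split=> // D DAC nnD.
have PD : P D.
  split=> // y; have /andP[-> DC] := DAC y.
  by have /andP[_] := CAB y; exact: le_trans.
rewrite -(Cmax (exist _ D PD))//.
by apply/asboolP => y; have /andP[] := DAC y.
Qed.

(** If no such [r] existed, every [m] with [0 < m x] would have total above [m x * e]. Lowering [C]
    by [d] at [x] alone would then keep all totals nonnegative, against minimality. *)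
Lemma minimal_upper_tight A C : (forall y, A y <= C y) -> nonneg_on A C ->
  (forall D, (forall y, A y <= D y <= C y) -> nonneg_on A D -> D = C) ->
  forall x e, A x < C x -> 0 < e ->
  exists r, [/\ K r, 0 < r x & total A C r <= (r x)%:~R * e].
Proof.
move=> AC nnC Cmin x e ACx e0; apply/not_existsP => H.
pose d := Num.min e (C x - A x).
have d0 : 0 < d by rewrite lt_min e0 subr_gt0.
pose D y := if y == x then C y - d else C y.
have /(_ _ _)/(congr1 (fun f => f x)) := Cmin D.
rewrite /D eqxx => /(_ _ _)/eqP; rewrite -subr_eq0 addrAC subrr sub0r oppr_eq0.
rewrite gt_eqF// => absurd; apply: notF; apply: absurd => [y|m Km].
  rewrite /D; case: eqP => [->|_]; last by rewrite AC lexx.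
  by rewrite gerBl (ltW d0) andbT lerBrDl -lerBrDr ge_min lexx orbT.
have [s hs] := K_fin Km.
rewrite (total_shift_upper _ _ _ _ hs) subr_ge0.
have [m0|_] := leP 0 (m x); last exact: nnC.
move: m0; rewrite le_eqVlt => /predU1P[<-|m0]; first by rewrite mul0r nnC.
rewrite leNgt; apply/negP => lt; apply: (H m); split=> //.
by rewrite (le_trans (ltW lt))// ler_pM2l ?ltr0z// ge_min lexx.
Qed.

(* One Fourier-Motzkin step per point of [S]: [m] with [m x < 0] is
   compensated at [x] by a nearly tight [r] with [0 < r x]. *)
Lemma raise_lower A C : (forall y, A y <= C y) -> nonneg_on A C ->
  (forall x e, A x < C x -> 0 < e ->
    exists r, [/\ K r, 0 < r x & total A C r <= (r x)%:~R * e]) ->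
  forall S : seq T, nonneg_on (fun y => if y \in S then C y else A y) C.
Proof.
move=> AC nnC tight; elim=> [|x S IH] m Km; first exact: nnC.
set A1 := fun y => if y \in x :: S then C y else A y.
set A0 := fun y => if y \in S then C y else A y in IH.
have A1C y : A1 y <= C y by rewrite /A1; case: ifP.
have AA1 y : A y <= A1 y by rewrite /A1; case: ifP.
have A01 y : y != x -> A0 y = A1 y by rewrite /A0 /A1 inE => /negPf ->.
have [s hs] := K_fin Km.
have [mx|mx] := leP 0 (m x).
  have -> : total A1 C m = total A0 C m.
    apply: eq_fsbigr => y _; have [->|yx] := eqVneq y x; last by rewrite A01.
    by rewrite /weight mx.
  exact: IH.
have [ACx|CAx] := ltP (A x) (C x); last first.
  suff -> : A1 = A0 by exact: IH.
  apply/funext => y; have [->|/A01//] := eqVneq y x.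
  have AxC : A x = C x by apply/le_anti; rewrite AC.
  by rewrite /A0 /A1 AxC !if_same.
apply/ler_addgt0Pr => e e0.
(* This tolerance turns into exactly [e] after scaling by [- m x] and dividing by [r x]. *)
have [|r [Kr rx tr]] := tight x (e / `|m x|%:~R) ACx.
  by rewrite divr_gt0// ltr0z normr_gt0 lt_eqF.
have [s' hs'] := K_fin Kr.
have [q rq] : exists q, r x = q.+1%:Z.
  by case: (r x) rx => [[|q]|]// _; exists q.
have [p mp] : exists p, m x = - p.+1%:Z.
  by case: (m x) mx => // p _; exists p.
(* The multipliers are [r x] and [- m x], so the combination vanishes at [x], the only point where
   [A0] and [A1] can differ. *)
have := IH _ (K_comb q p Km Kr).
have -> : total A0 C (fun y => q.+1%:Z * m y + p.+1%:Z * r y) =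
          total A1 C (fun y => q.+1%:Z * m y + p.+1%:Z * r y).
  apply: eq_total => // y; have [->|/A01//] := eqVneq y x.
  by rewrite rq mp mulrN mulrC addNr eqxx.
move=> /le_trans/(_ (total_comb q.+1 p.+1 hs hs' A1C)).
have /le_trans/(_ tr) : total A1 C r <= total A C r by apply: (total_le hs').
rewrite rq mp normrN /= -!pmulrn => tr1 le0.
have : p.+1%:R * total A1 C r <= q.+1%:R * e.
  rewrite -ler_pdivlMl ?ltr0n// (le_trans tr1)//.
  by rewrite [p.+1%:R^-1 * _]mulrC -mulrA.
move=> le1; have := le_trans le0 (lerD (lexx _) le1).
by rewrite -mulrDr pmulr_rge0 ?ltr0n.
Qed.

Theorem feasible A B : (forall y, A y <= B y) -> nonneg_on A B ->
  exists C, (forall y, A y <= C y <= B y) /\ nonneg_on C C.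
Proof.
move=> AB nnB; have [C [CAB nnC Cmin]] := minimal_upper AB nnB.
exists C; split=> // m Km.
have AC y : A y <= C y by have /andP[] := CAB y.
have [s hs] := K_fin Km.
(* Raising the lower function on the finite list [s] is enough, since [total] ignores the points
   where [m] vanishes. *)
have := raise_lower AC nnC (minimal_upper_tight AC nnC Cmin) s Km.
congr (0 <= _); apply: eq_total => // y my; case: ifPn => // /hs m0.
by rewrite m0 eqxx in my.
Qed.

End Feasibility.

(** * Box multiplicities, volumes and faces *)

Section Boxes.
Variables (R : realType) (n : nat).
Implicit Types (x y v : 'rV[R]_n) (b : box R n) (f g : 'rV[R]_n -> R).

(** The one-dimensional factor of the multiplicity: [1] at the upper end, [-1] at the lower end, and
    just [1] on a degenerate side, in accordance with the term [n - k] in the sign. *)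
Definition edge (s t u : R) : int :=
  (u == t)%:Z - ((s < t) && (u == s))%:Z.

Lemma box_mult_prod b v : (forall i, b.1 0 i <= b.2 0 i) ->
  box_mult b v = \prod_i edge (b.1 0 i) (b.2 0 i) (v 0 i).
Proof.
move=> b12; rewrite /box_mult; case: ifPn => [/forallP vb|]; last first.
  rewrite negb_forall => /existsP[i]; rewrite negb_or => /andP[v1 v2].
  by rewrite (bigD1 i)//= /edge (negPf v1) (negPf v2) andbF mul0r.
rewrite /box_sign /box_dim.
set P := [pred i | v 0 i == b.1 0 i]; set Q := [pred i | b.1 0 i < b.2 0 i].
(* Every degenerate index lies in [P], so subtracting their number leaves the nondegenerate indices
   where [v] is at the lower end. *)
have -> : (#|P| - (n - #|Q|))%N = #|[predI P & Q]|.
  have -> : (n - #|Q|)%N = #|predC Q|.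
    by rewrite -{1}[n]card_ord -(cardC Q) addKn.
  rewrite -(cardID Q P).
  suff -> : #|[predD P & Q]| = #|predC Q| by rewrite addnK.
  apply: eq_card => i; rewrite !inE /=.
  have [//|b21] := ltP (b.1 0 i) (b.2 0 i).
  have b1E : b.1 0 i = b.2 0 i by apply/le_anti; rewrite b12.
  by have := vb i; rewrite b1E orbb => ->.
rewrite -prodr_const big_mkcond/=; apply: eq_bigr => i _; rewrite !inE /edge.
have := vb i; have := b12 i.
have [lt _|//|eq _] := ltgtP (b.1 0 i) (b.2 0 i).
  by case: eqVneq => [->|_] /= => [_|->]; rewrite ?(lt_eqF lt).
by rewrite eq orbb => ->; rewrite andbF.
Qed.

Definition upd x (i : 'I_n) (t : R) : 'rV[R]_n :=
  \row_j if j == i then t else x 0 j.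

Lemma updE x i t j : upd x i t 0 j = if j == i then t else x 0 j.
Proof. by rewrite mxE. Qed.

Lemma upd_same x i t : upd x i t 0 i = t.
Proof. by rewrite updE eqxx. Qed.

Lemma upd_id x i : upd x i (x 0 i) = x.
Proof. by apply/rowP => j; rewrite updE; case: eqP => [->|]. Qed.

Lemma upd_upd x i s t : upd (upd x i s) i t = upd x i t.
Proof. by apply/rowP => j; rewrite !updE; case: eqP. Qed.

Lemma updC x i j s t : i != j ->
  upd (upd x i s) j t = upd (upd x j t) i s.
Proof.
move=> ij; apply/rowP => l; rewrite !updE.
by case: (eqVneq l j) => [->|//]; rewrite eq_sym (negPf ij).
Qed.

Lemma cube_upd x i t : cube x -> 0 <= t <= 1 -> cube (upd x i t).
Proof. by move=> cx t01 j; rewrite updE; case: ifP. Qed.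

(** Degenerate sides make entries repeat, hence the [undup] in sums over this list. *)
Definition verts b : seq 'rV[R]_n :=
  [seq \row_i (if (e : {ffun 'I_n -> bool}) i then b.2 0 i else b.1 0 i)
     | e <- enum {ffun 'I_n -> bool}].

Lemma mem_verts b v : is_vertex b v -> v \in verts b.
Proof.
move=> /forallP vb; apply/mapP.
exists [ffun i => v 0 i == b.2 0 i]; first by rewrite mem_enum.
apply/rowP => i; rewrite mxE ffunE; have := vb i.
by case: (eqVneq (v 0 i) (b.2 0 i)) => [->//|_]; rewrite orbF => /eqP.
Qed.

Lemma box_mult_verts b : vanishes_off (verts b) (box_mult b).
Proof.
by move=> v; rewrite /box_mult; case: ifP => // /mem_verts ->.
Qed.

Lemma mult_verts (bs : seq (box R n)) :
  vanishes_off (flatten [seq verts b | b <- bs]) (mult bs).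
Proof.
move=> v vbs; rewrite /mult big1_seq// => b /= bbs.
apply: box_mult_verts; apply: contra vbs => vb.
by apply/flattenP; exists (verts b); rewrite ?map_f.
Qed.

Lemma mult_cat (bs bs' : seq (box R n)) v :
  mult (bs ++ bs') v = mult bs v + mult bs' v.
Proof. by rewrite /mult big_cat. Qed.

Lemma mult_seq1 b : mult [:: b] = box_mult b.
Proof. by apply/funext => v; rewrite /mult big_seq1. Qed.

Lemma L_total (A B : 'rV[R]_n -> R) bs : L A B bs = total A B (mult bs).
Proof.
have ms := @mult_verts bs; set s := flatten _ in ms.
have sum_part (P : set 'rV[R]_n) (F : 'rV[R]_n -> R) :
  (forall v, mult bs v = 0 -> F v = 0) ->
  \sum_(y \in P) F y = \sum_(y <- undup s) (if y \in P then F y else 0).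
  move=> F0; rewrite fsbig_mkcond [RHS]fsbig_seq ?undup_uniq//.
  apply: esym; apply: fsbig_widen => // v [_ /= /negP].
  by rewrite mem_undup /patch => /ms /F0 ->; case: ifP.
rewrite (totalE _ _ ms) /L !sum_part => [|v ->|v ->]; rewrite ?mul0r//.
rewrite -big_split/=; apply: eq_bigr => v _; rewrite /weight.
have mem1 : (v \in [set y | 0 < mult bs y]) = (0 < mult bs v).
  by apply/idP/idP; rewrite inE.
have mem2 : (v \in [set y | mult bs y < 0]) = (mult bs v < 0).
  by apply/idP/idP; rewrite inE.
rewrite mem1 mem2; case: ltgtP => [||<-]; rewrite ?addr0 ?add0r ?mul0r//.
Qed.

(** With equal lower and upper functions [total] is linear in the multiplicities; this is the signed
    sum of [k_increasing], by [volume_sign]. *)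
Definition volume b f : R := total f f (box_mult b).

Lemma volumeE b f s : vanishes_off s (box_mult b) ->
  volume b f = \sum_(v <- undup s) (box_mult b v)%:~R * f v.
Proof.
by move=> bs; rewrite /volume (totalE _ _ bs); under eq_bigr do
  rewrite weight_diag.
Qed.

Lemma volume_sign b f :
  \sum_(v \in ver b) (box_sign b v)%:~R * f v = volume b f.
Proof.
rewrite fsbig_mkcond; apply: eq_fsbigr => v _.
rewrite weight_diag /patch /box_mult.
have -> : (v \in ver b) = is_vertex b v by apply/idP/idP; rewrite inE.
by case: ifP => _; rewrite ?mul0r.
Qed.

Lemma volume_point x f : volume (x, x) f = f x.
Proof.
have hx : vanishes_off [:: x] (box_mult (x, x)).
  move=> v; rewrite inE => vx; rewrite box_mult_prod//=.
  have [i vxi] : exists i, v 0 i != x 0 i.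
    by apply/existsP; rewrite -negb_forall; apply: contra vx => /forallP vx;
       apply/eqP/rowP => i; apply/eqP.
  by rewrite (bigD1 i)//= /edge ltxx (negPf vxi) mul0r.
rewrite (volumeE _ hx) /= big_seq1 box_mult_prod//=.
by rewrite big1 ?mul1r// => i _; rewrite /edge ltxx eqxx.
Qed.

(** In direction [i] the factor [edge] is a difference of two point indicators, and these are the
    factors of the two opposite faces. *)
Lemma box_mult_face b i v : (forall i, b.1 0 i <= b.2 0 i) ->
  b.1 0 i < b.2 0 i ->
  box_mult b v = box_mult (upd b.1 i (b.2 0 i), b.2) v -
                 box_mult (b.1, upd b.2 i (b.1 0 i)) v.
Proof.
move=> b12 bi; rewrite !box_mult_prod//=; last first.
- by move=> j; rewrite updE; case: eqP => [->|].
- by move=> j; rewrite updE; case: eqP => [->|].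
have prodE (x y : 'rV[R]_n) :
  (forall j, j != i -> x 0 j = b.1 0 j /\ y 0 j = b.2 0 j) ->
  \prod_j edge (x 0 j) (y 0 j) (v 0 j) = edge (x 0 i) (y 0 i) (v 0 i) *
    \prod_(j | j != i) edge (b.1 0 j) (b.2 0 j) (v 0 j).
  move=> xy; rewrite (bigD1 i)//=; congr (_ * _); apply: eq_bigr => j ji.
  by have [-> ->] := xy j ji.
rewrite (prodE b.1 b.2)// (prodE _ b.2) => [|j /negPf ji]; last first.
  by rewrite updE ji.
rewrite (prodE b.1) => [|j /negPf ji]; last by rewrite updE ji.
by rewrite -mulrBl /edge !upd_same bi !ltxx /= !subr0.
Qed.

Lemma volume_face b i f : (forall i, b.1 0 i <= b.2 0 i) ->
  b.1 0 i < b.2 0 i ->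
  volume b f = volume (upd b.1 i (b.2 0 i), b.2) f -
               volume (b.1, upd b.2 i (b.1 0 i)) f.
Proof.
move=> b12 bi; set u := (_, b.2); set l := (b.1, _).
have [hu hl] := cat_vanishes (@box_mult_verts u) (@box_mult_verts l).
rewrite (volumeE f hu) (volumeE f hl).
rewrite (@volumeE _ _ (verts u ++ verts l)) => [|v vs]; last first.
  by rewrite (box_mult_face v b12 bi) hu// hl// subrr.
rewrite -sumrB; apply: eq_bigr => v _.
by rewrite (box_mult_face v b12 bi) rmorphB mulrBl.
Qed.

Lemma kbox_cube k b v : is_kbox k b -> box_mult b v != 0 -> cube v.
Proof.
move=> [c1 c2 _ _]; rewrite /box_mult; case: ifP => // /forallP vb _ i.
by have /orP[/eqP ->|/eqP ->] := vb i.
Qed.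

Lemma mult_cube k bs v : kbox_unions k bs -> mult bs v != 0 -> cube v.
Proof.
move=> kbs; apply: contra_neqP => ncv; rewrite /mult big1_seq// => b /= bbs.
by apply/eqP; apply: contra_notT ncv; apply: kbox_cube (kbs _ bbs).
Qed.

Lemma volume_grounded b i f : grounded f ->
  cube b.1 -> cube b.2 -> (forall i, b.1 0 i <= b.2 0 i) ->
  b.2 0 i = 0 -> volume b f = 0.
Proof.
move=> gf c1 c2 b12 bi; rewrite /volume /total fsbig1// => v _.
have [->|bv] := eqVneq (box_mult b v) 0; first by rewrite weight0.
rewrite weight_diag gf ?mulr0//.
  by apply: (@kbox_cube (box_dim b) b).
move: bv; rewrite /box_mult; case: ifP => // /forallP/(_ i) vb _; exists i.
have b1i : b.1 0 i = 0.
  by apply/le_anti; rewrite -{1}bi b12/=; have /andP[] := c1 i.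
by move: vb; rewrite b1i bi orbb => /eqP.
Qed.

(** A j-box with [j < n] has a degenerate side. Stretching that side down to 0 adds a face of volume
    0 by groundedness, so the resulting box of dimension [j.+1] has the same volume. If the side
    already sits at 0, the volume itself is 0. *)
Lemma k_increasing_lower j f : (0 < j < n)%N -> grounded f ->
  k_increasing j.+1 f -> k_increasing j f.
Proof.
move=> /andP[j0 jn] gf kf b kb; have [c1 c2 b12 dimb] := kb.
have [i bi] : exists i, b.2 0 i <= b.1 0 i.
  apply/not_existsP => H; move: jn; rewrite -dimb /box_dim eq_cardT.
    by rewrite size_enum_ord ltnn.
  by move=> i; rewrite inE ltNge; apply/negP; exact: H.
have {}bi : b.2 0 i = b.1 0 i by apply/le_anti; rewrite bi b12.
rewrite volume_sign.
have [bi0|bi0] := eqVneq (b.2 0 i) 0.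
  by rewrite (volume_grounded gf c1 c2 b12 bi0).
have bi_gt0 : 0 < b.2 0 i.
  by rewrite lt_neqAle eq_sym bi0/=; have /andP[] := c2 i.
pose b' : box R n := (upd b.1 i 0, b.2).
have b12' l : b'.1 0 l <= b'.2 0 l.
  by rewrite /= updE; case: eqP => [->|_//]; exact: ltW.
have c1' : cube b'.1 by apply: cube_upd; rewrite // lexx ler01.
have kb' : is_kbox j.+1 b'.
  split=> //; rewrite -dimb /box_dim (cardD1 i) [in RHS](cardD1 i) !inE /=.
  rewrite upd_same bi_gt0 bi ltxx add0n add1n; congr _.+1; apply: eq_card => l.
  by rewrite !inE /= updE; case: eqP.
have := kf _ kb'; rewrite volume_sign (@volume_face b' i) ?upd_same//=.
rewrite upd_upd bi upd_id -surjective_pairing.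
rewrite (@volume_grounded (_, _) i) ?subr0//= ?upd_same//.
  by apply: cube_upd; rewrite // lexx ler01.
by move=> l; rewrite !updE; case: eqP.
Qed.

Lemma k_increasing_anti j k f : (0 < j <= k)%N -> (k <= n)%N -> grounded f ->
  k_increasing k f -> k_increasing j f.
Proof.
move=> /andP[j0 jk] kn gf.
elim: k jk kn => [|k IH] jk kn; first by rewrite leqn0 in jk; rewrite (eqP jk).
move: jk; rewrite leq_eqVlt => /predU1P[->//|jk].
move=> /k_increasing_lower kf; apply: IH => //; first exact: ltnW.
by apply: kf; rewrite // (leq_trans j0 jk).
Qed.

End Boxes.

(** * Monotonicity and Lipschitz continuity of semicopulas *)

Section Semicopulas.
Variables (R : realType) (n : nat).
Implicit Types (x y v : 'rV[R]_n) (b : box R n) (f A B C : 'rV[R]_n -> R).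

Lemma volume_edge f x i (s t : R) : s < t ->
  volume (upd x i s, upd x i t) f = f (upd x i t) - f (upd x i s).
Proof.
move=> st; rewrite (@volume_face _ _ (_, _) i) /= ?upd_same//.
  by rewrite !upd_upd !volume_point.
by move=> j; rewrite !updE; case: eqP => // _; exact: ltW.
Qed.

Lemma increasing_upd f x i (s t : R) : k_increasing 1 f -> cube x ->
  0 <= s -> s <= t -> t <= 1 -> f (upd x i s) <= f (upd x i t).
Proof.
move=> f1 cx s0 st t1; move: (st); rewrite le_eqVlt => /predU1P[->//|lt].
pose b : box R n := (upd x i s, upd x i t).
have b12 j : b.1 0 j <= b.2 0 j by rewrite /= !updE; case: eqP.
have kb : is_kbox 1 b.
  split=> //; try by apply: cube_upd => //; lra.
  by rewrite /box_dim; apply: (@fintype.eq_card1 _ i) => j;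
    rewrite !inE !updE; case: eqP; rewrite ?ltxx.
by have := f1 _ kb; rewrite volume_sign volume_edge// subr_ge0.
Qed.

(** The volume of a 2-box is the increment in direction [i] at level [q] minus the one at level
    [p]. *)
Lemma supermodular_upd f x i j (s t p q : R) : k_increasing 2 f -> cube x ->
  i != j -> 0 <= s -> s <= t -> t <= 1 -> 0 <= p -> p <= q -> q <= 1 ->
  f (upd (upd x i t) j p) - f (upd (upd x i s) j p) <=
  f (upd (upd x i t) j q) - f (upd (upd x i s) j q).
Proof.
move=> f2 cx ij s0 st t1 p0 pq q1.
move: (st); rewrite le_eqVlt => /predU1P[->|st']; first by rewrite !subrr.
move: (pq); rewrite le_eqVlt => /predU1P[->//|pq'].
have ji : j != i by rewrite eq_sym.
pose b : box R n := (upd (upd x i s) j p, upd (upd x i t) j q).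
have b12 l : b.1 0 l <= b.2 0 l.
  by rewrite /= !updE; case: eqP => //; case: eqP.
have kb : is_kbox 2 b.
  split=> //; try by do 2 (apply: cube_upd; last by lra).
  have -> : 2%N = #|[set i; j]%SET| by rewrite cards2 ij.
  rewrite /box_dim; apply: eq_card => l; rewrite !inE /= !updE.
  have [->|lj] := eqVneq l j; first by rewrite pq' orbT.
  by have [//|li] := eqVneq l i; rewrite ltxx.
have bj : b.1 0 j < b.2 0 j by rewrite /= !upd_same.
have := f2 _ kb; rewrite volume_sign (volume_face f b12 bj)/=.
rewrite !upd_same !upd_upd ![upd (upd x i _) j _]updC// !volume_edge//.
by rewrite subr_ge0.
Qed.

(** Induction on the number of coordinates other than [i] that differ from 1. It reduces claims to
    the edge where uniform marginals give the values. *)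
Lemma raise_ind (i : 'I_n) (P : 'rV[R]_n -> Prop) :
  (forall y j, cube y -> j != i -> P (upd y j 1) -> P y) ->
  forall x, cube x -> P (\row_j (if j == i then x 0 i else 1)) -> P x.
Proof.
move=> raise x; have [m] := ubnP #|[pred j | (j != i) && (x 0 j != 1)]|.
elim: m x => // m IH x lt cx Px.
have [/existsP[j /andP[ji xj]]|] :=
  boolP [exists j, (j != i) && (x 0 j != 1)]; last first.
  rewrite negb_exists => /forallP x1; move: Px.
  suff -> : \row_j (if j == i then x 0 i else 1) = x by [].
  apply/rowP => j; rewrite mxE; case: eqP => [->//|/eqP ji].
  by have := x1 j; rewrite ji negbK => /eqP.
apply: (raise _ j) => //; apply: IH.
- rewrite -ltnS; apply: leq_trans lt.
  rewrite ltnS (cardD1 j [pred j | (j != i) && (x 0 j != 1)]) inE /= ji xj.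
  rewrite add1n; apply: subset_leq_card; apply/fintype.subsetP => l.
  by rewrite !inE /= updE; have [->|//] := eqVneq l j; rewrite eqxx andbF.
- by apply: cube_upd; rewrite // ler01 lexx.
- by move: Px; rewrite updE eq_sym (negPf ji).
Qed.

Lemma semicopula_le_coord f x i : semicopula f -> cube x -> f x <= x 0 i.
Proof.
move=> [_ _ f1 fm] cx; apply: (@raise_ind i (fun x => f x <= x 0 i)) => //.
- move=> y j cy ji; rewrite updE eq_sym (negPf ji); apply: le_trans.
  by have /andP[? ?] := cy j; rewrite -{1}(upd_id y j) increasing_upd.
- by rewrite fm ?mxE ?eqxx.
Qed.

(** By supermodularity the increment in direction [i] grows as the other coordinates are raised to
    1, where it equals [t - s]. *)
Lemma lipschitz_upd f x i (s t : R) : semicopula f -> k_increasing 2 f ->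
  cube x -> 0 <= s <= 1 -> 0 <= t <= 1 ->
  `|f (upd x i s) - f (upd x i t)| <= `|s - t|.
Proof.
move=> [_ _ f1 fm] f2 cx.
wlog st : s t / s <= t => [H s01 t01|/andP[s0 _] /andP[_ t1]].
  have [/H|/ltW/H] := leP s t; first exact.
  by rewrite distrC [X in _ -> _ -> _ <= X]distrC; apply.
rewrite distrC [leRHS]distrC !ger0_norm ?subr_ge0//; last first.
  exact: increasing_upd.
apply: (@raise_ind i (fun x => f (upd x i t) - f (upd x i s) <= t - s)) => //.
- move=> y j cy ji; apply: le_trans; have /andP[y0 y1] := cy j.
  have ij : i != j by rewrite eq_sym.
  have := supermodular_upd f2 cy ij s0 st t1 y0 y1 (lexx 1).
  by rewrite ![upd (upd y i _) j _]updC// upd_id.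
- have row1 u : upd (\row_j (if j == i then x 0 i else 1)) i u =
                \row_j (if j == i then u else 1).
    by apply/rowP => j; rewrite updE !mxE; case: eqP.
  by rewrite !row1 !fm//; lra.
Qed.

Lemma one_lipschitz_semicopula f : semicopula f -> k_increasing 2 f ->
  one_lipschitz f.
Proof.
move=> sf f2 x y cx cy.
(* These hybrids lead from [x] to [y] by changing one coordinate at a time. *)
pose h m : 'rV[R]_n := \row_j (if (j < m)%N then y 0 j else x 0 j).
have ch m : cube (h m) by move=> j; rewrite mxE; case: ifP.
suff H m : (m <= n)%N ->
    `|f x - f (h m)| <= \sum_(j < n | (j < m)%N) `|x 0 j - y 0 j|.
  have := H n (leqnn n); have -> : h n = y.
    by apply/rowP => j; rewrite mxE ltn_ord.
  by rewrite [leRHS](eq_bigl xpredT) => // j; exact: ltn_ord.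
elim: m => [_|m IH mn].
  have -> : h 0%N = x by apply/rowP => j; rewrite mxE.
  by rewrite subrr normr0 sumr_ge0.
pose i := Ordinal mn.
have hm : h m = upd (h m) i (x 0 i).
  by rewrite -[LHS](upd_id _ i) mxE ltnn.
have hm1 : h m.+1 = upd (h m) i (y 0 i).
  apply/rowP => j; rewrite updE !mxE ltnS leq_eqVlt.
  by have [->|ji] := eqVneq j i; rewrite ?eqxx// -[_ == m]/(j == i) (negPf ji).
rewrite (bigD1 i) ?ltnS//= addrC.
apply: le_trans (ler_distD (f (h m)) _ _) _; apply: lerD.
  apply: le_trans (IH (ltnW mn)) _; rewrite le_eqVlt; apply/orP; left.
  apply/eqP/eq_bigl => j; have [->|ji] := eqVneq j i.
    by rewrite /= ltnn andbF.
  by rewrite andbT [RHS]ltnS [in RHS]leq_eqVlt -[_ == m]/(j == i) (negPf ji).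
by rewrite {1}hm hm1; apply: lipschitz_upd.
Qed.

(** Groundedness and marginals are squeezed between those of [A] and [B]; monotonicity descends from
    [k] to 1. *)
Lemma semicopula_between k A B C : (0 < k <= n)%N -> semicopula A ->
  semicopula B -> fle A C -> fle C B -> k_increasing k C -> semicopula C.
Proof.
move=> /andP[k0 kn] [uA gA _ mA] [uB gB _ mB] AC CB kC.
have gC : grounded C.
  move=> x cx x0; apply/le_anti.
  by rewrite -{1}(gB x cx x0) CB//= -(gA x cx x0) AC.
split=> //.
- move=> x cx; have /andP[A0 _] := uA x cx; have /andP[_ B1] := uB x cx.
  by rewrite (le_trans A0 (AC x cx)) (le_trans (CB x cx) B1).
- by apply: (@k_increasing_anti _ _ 1 k).
- move=> i t t01; have ct : cube (\row_j (if j == i then t else 1)).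
    by move=> j; rewrite mxE; case: ifP => // _; rewrite ler01 lexx.
  by apply/le_anti; have := CB _ ct; have := AC _ ct;
    rewrite mA// mB// => -> ->.
Qed.

End Semicopulas.

(** * Transfer to unions of k-boxes *)

Section Unions.
Variables (R : realType) (n k : nat) (A B : 'rV[R]_n -> R).
Implicit Types (x v : 'rV[R]_n) (C : 'rV[R]_n -> R) (bs : seq (box R n)).

Lemma total_mult_ge0 C bs : k_increasing k C -> kbox_unions k bs ->
  0 <= total C C (mult bs).
Proof.
move=> kC; elim: bs => [|b bs IH] kbs.
  by rewrite /total fsbig1// => v _; rewrite /mult big_nil weight0.
have bbs : kbox_unions k bs by move=> c cbs; apply: kbs; rewrite inE cbs orbT.
have -> : total C C (mult (b :: bs)) = volume b C + total C C (mult bs).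
  have [hb hbs] := cat_vanishes (@box_mult_verts _ _ b) (@mult_verts _ _ bs).
  rewrite (volumeE C hb) (totalE C C hbs).
  rewrite (@totalE _ _ _ _ _ (verts b ++ flatten [seq verts c | c <- bs])).
    rewrite -big_split/=; apply: eq_bigr => v _.
    by rewrite !weight_diag /mult big_cons rmorphD mulrDl.
  by move=> v vs; rewrite /mult big_cons -/(mult bs v) hb// hbs.
rewrite addr_ge0 ?IH// -volume_sign.
by apply: kC; apply: kbs; rewrite mem_head.
Qed.

Lemma kbox_unions_feasible : fle A B ->
  (forall bs, kbox_unions k bs -> 0 <= L A B bs) ->
  exists C, [/\ fle A C, fle C B & k_increasing k C].
Proof.
move=> AB hL; pose A0 v := Num.min (A v) (B v).
pose K := [set mult bs | bs in @kbox_unions R n k].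
have A0E v : cube v -> A0 v = A v by move=> cv; rewrite /A0 min_l// AB.
have [||||C [ACB nnC]] := @feasible R _ K _ _ A0 B.
- move=> _ _ [bs kbs <-] [cs kcs <-]; exists (bs ++ cs).
    by move=> b; rewrite mem_cat => /orP[/kbs|/kcs].
  by apply/funext => v; rewrite mult_cat.
- by move=> _ [bs _ <-]; exists (flatten [seq verts b | b <- bs]);
    apply: mult_verts.
- by move=> v; rewrite ge_min lexx orbT.
- move=> _ [bs kbs <-]; have := hL _ kbs; rewrite L_total.
  by congr (0 <= _); apply: eq_total => // v /(mult_cube kbs)/A0E.
exists C; split.
- by move=> v cv; have /andP[+ _] := ACB v; rewrite A0E.
- by move=> v _; have /andP[] := ACB v.
- move=> b kb; rewrite volume_sign /volume -mult_seq1; apply: nnC.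
  by exists [:: b] => // c; rewrite inE => /eqP ->.
Qed.

(** Lowering [B] to [C x] at [x] subtracts exactly the left side from [L]. What remains dominates
    the total of [C] with itself, which is nonnegative. *)
Lemma gap_le_L C bs x : k_increasing k C -> fle A C -> fle C B ->
  kbox_unions k bs -> 0 < mult bs x ->
  (mult bs x)%:~R * (B x - C x) <= L A B bs.
Proof.
move=> kC AC CB kbs mx; have ms := @mult_verts _ _ bs.
rewrite L_total -subr_ge0.
have := @total_shift_upper _ _ A B _ _ x (B x - C x) ms.
rewrite (ltW mx) => <-; apply: le_trans (total_mult_ge0 kC kbs) _.
apply: (total_le ms) => v /(mult_cube kbs) cv; split; first exact: AC.
by case: eqP => [->|_]; [rewrite opprB addrC subrK|exact: CB].
Qed.

End Unions.

(** * The two implications between (i) and (ii) *)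

Section Bounds.
Variables (R : realType) (n k : nat) (A B : 'rV[R]_n -> R).
Hypotheses (hk : (1 < k <= n)%N) (hA : semicopula A) (hB : semicopula B).
Hypotheses (hAB : fle A B)
  (hL : forall bs : seq (box R n), kbox_unions k bs -> 0 <= L A B bs).
Implicit Types (x v : 'rV[R]_n) (C : 'rV[R]_n -> R) (bs : seq (box R n)).

Let cond_i := forall x, cube x -> PM k A B x = (B x - A x)%:E.
Let cond_ii := forall x, cube x ->
  (A x)%:E = ereal_inf [set (C x)%:E | C in between_kinc_semicopulas k A B].

Let k_gt0 : (0 < k <= n)%N.
Proof. by case/andP: hk => /ltnW -> ->. Qed.

Lemma quasicopula_of_inf : cond_ii -> quasicopula A.
Proof.
move=> h2; split=> //.
suff lip x y : cube x -> cube y -> A x - A y <= \sum_i `|x 0 i - y 0 i|.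
  move=> x y cx cy; rewrite ler_norml lerNl opprB lip// andbT.
  by rewrite (le_trans (lip _ _ cy cx))//; apply: ler_sum => i _;
    rewrite distrC.
move=> cx cy; rewrite lerBlDr -lerBlDl -lee_fin (h2 y cy).
apply/ereal_infP => _ [C [AC _ kC sC] <-]; rewrite lee_fin lerBlDl.
rewrite (le_trans (AC _ cx))// -lerBlDr (le_trans (ler_norm _))//.
apply: one_lipschitz_semicopula => //.
by case: sC => _ gC _ _; case/andP: hk => ? ?;
  apply: (@k_increasing_anti _ _ 2 k).
Qed.

Lemma inf_of_PM : cond_i -> cond_ii.
Proof.
move=> h1 x cx.
pose B' v := if v == x then B v - (B x - A x) else B v.
have AB' : fle A B'.
  move=> v cv; rewrite /B'; case: eqP => [->|_]; last exact: hAB.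
  by rewrite opprB addrC subrK.
have B'B : fle B' B.
  move=> v cv; rewrite /B'; case: eqP => [->|_]; last exact: lexx.
  by rewrite gerBl subr_ge0 hAB.
have hL' bs : kbox_unions k bs -> 0 <= L A B' bs.
  move=> kbs; have ms := @mult_verts _ _ bs.
  rewrite L_total (total_shift_upper _ _ _ _ ms).
  rewrite -L_total subr_ge0; case: ifPn => [m0|_]; last exact: hL.
  move: m0; rewrite le_eqVlt => /predU1P[<-|m0]; first by rewrite mul0r hL.
  (* The union competes in its own infimum, so the default value 0 is excluded and (i) bounds its
     ratio below by [B x - A x]. *)
  have in_ratios : PM_ratios k A B x (L A B bs / `|mult bs x|%:~R)%:E.
    by exists bs.
  have := h1 x cx; rewrite /PM; case: asboolP => [e|_ e].
    by rewrite e in in_ratios.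
  have := ereal_inf_lbound in_ratios; rewrite e lee_fin gtr0_norm//.
  by rewrite ler_pdivlMr ?ltr0z// mulrC.
have [C [AC CB' kC]] := kbox_unions_feasible AB' hL'.
have CB : fle C B by move=> v cv; exact: le_trans (CB' v cv) (B'B v cv).
have sC : semicopula C by exact: (semicopula_between k_gt0 hA hB).
apply/le_anti/andP; split.
  by apply/ereal_infP => _ [D [AD _ _ _] <-]; rewrite lee_fin AD.
apply: ereal_inf_lbound; exists C => //; congr _%:E.
apply/le_anti; rewrite AC// andbT.
by have := CB' x cx; rewrite /B' eqxx opprB addrC subrK.
Qed.

(** Each admissible [C] bounds the ratio below by [B x - C x]; by (ii) the infimum of [C x] is
    [A x]. *)
Lemma PM_ratios_ge x y : cond_ii -> cube x -> PM_ratios k A B x y ->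
  ((B x - A x)%:E <= y)%E.
Proof.
move=> h2 cx [bs [kbs m0] <-].
rewrite lee_fin gtr0_norm// lerBlDl -lerBlDr -lee_fin (h2 x cx).
apply/ereal_infP => _ [C [AC CB kC _] <-].
rewrite lee_fin lerBlDr -lerBlDl ler_pdivlMr ?ltr0z// mulrC.
exact: (gap_le_L kC).
Qed.

(* Use the box [a, x] with a = (max(0, x_0 - e), 0, ..., 0, x_k, ..., x_(n-1)):
   its only vertices off the zero faces are [x] and [x] with x_0 replaced by
   a_0, so its [L] is [B x] minus a value of [A] within [e] of [A x]. *)
Lemma PM_ratios_pos x e : cube x -> (forall i, 0 < x 0 i) ->
  one_lipschitz A -> 0 < e ->
  exists2 y, PM_ratios k A B x y & (y <= (B x - A x + e)%:E)%E.
Proof.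
move=> cx x_gt0 lipA e0; case/andP: k_gt0 => k0 kn.
pose i0 := Ordinal (leq_trans k0 kn).
pose t := Num.max 0 (x 0 i0 - e).
have xi0 := x_gt0 i0; have /andP[_ xi1] := cx i0.
have t0 : 0 <= t by rewrite le_max lexx.
have tx : t < x 0 i0 by rewrite gt_max xi0 gtrBl.
pose a : 'rV[R]_n :=
  \row_j if j == i0 then t else if (j < k)%N then 0 else x 0 j.
pose b : box R n := (a, x).
have ca : cube a.
  move=> j; rewrite mxE; case: eqP => _; first by lra.
  by case: ifP => // _; rewrite lexx ler01.
have b12 j : b.1 0 j <= b.2 0 j.
  rewrite /= mxE; case: eqP => [->|_]; first exact: ltW.
  by case: ifP => // _; exact: ltW.
have kb : is_kbox k b.
  split=> //; transitivity (\sum_(j < n | (j < k)%N) 1)%N.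
    rewrite /box_dim -sum1_card; apply: eq_bigl => j; rewrite !inE /= mxE.
    case: eqP => [->|_]; first by rewrite tx /= k0.
    by case: ifP => jk; rewrite ?x_gt0 ?ltxx.
  by rewrite (big_ord_narrow kn) sum1_card card_ord.
pose x' := upd x i0 t.
have cx' : cube x' by apply: cube_upd => //; lra.
have x'x : x' != x.
  by apply/eqP => /rowP/(_ i0)/eqP; rewrite upd_same (lt_eqF tx).
have edge_top j : edge (a 0 j) (x 0 j) (x 0 j) = 1.
  by rewrite /edge eqxx; have [/gt_eqF ->|] := ltP (a 0 j).
have mx : box_mult b x = 1 by rewrite box_mult_prod// big1.
have mx' : box_mult b x' = -1.
  rewrite box_mult_prod// (bigD1 i0)//= big1 => [|j /negPf ji]; last first.
    by rewrite updE ji.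
  by rewrite upd_same mxE eqxx /edge tx eqxx (lt_eqF tx).
have m0 v : v != x -> v != x' -> weight (A v) (B v) (box_mult b v) = 0.
  move=> vx vx'; have [->|mv] := eqVneq (box_mult b v) 0.
    by rewrite weight0.
  have cv := kbox_cube kb mv.
  have /forallP vb : is_vertex b v by move: mv; rewrite /box_mult; case: ifP.
  (* A vertex agreeing with [x] outside [i0] is [x] or [x']. Any other one has a coordinate at a
     lower end different from [x 0 j], which is 0. *)
  have [j ji vj] : exists2 j, j != i0 & v 0 j != x 0 j.
    apply/exists2P; apply: contrapT => H.
    have {}H j : j != i0 -> v 0 j = x 0 j.
      move=> ji; apply/eqP/negPn/negP => vj; apply: H; exists j; split=> //.
    have /orP[/eqP vi|/eqP vi] := vb i0.
      move/eqP: vx'; apply; apply/rowP => j; rewrite updE.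
      by case: eqP => [->|/eqP/H//]; rewrite vi /= mxE eqxx.
    move/eqP: vx; apply; apply/rowP => j.
    by have [->|/H//] := eqVneq j i0.
  have vj0 : v 0 j = 0.
    have := vb j; rewrite /= (negPf vj) orbF mxE (negPf ji).
    by case: ifP => _ /eqP // vjx; rewrite vjx eqxx in vj.
  have ex0 : exists j, v 0 j = 0 by exists j.
  by case: hA hB => [_ gA _ _] [_ gB _ _];
  rewrite gA// gB// /weight if_same mulr0.
have kbs : kbox_unions k [:: b] by move=> c; rewrite inE => /eqP ->.
exists (L A B [:: b] / `|mult [:: b] x|%:~R)%:E.
  by exists [:: b] => //; split=> //; rewrite mult_seq1 mx.
rewrite lee_fin mult_seq1 mx normr1 divr1 L_total mult_seq1.
have hv : vanishes_off (verts b) (box_mult b) by exact: box_mult_verts.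
rewrite (totalE _ _ hv).
have vx : x \in undup (verts b).
  by rewrite mem_undup; apply: contraT => /hv; rewrite mx.
have vx' : x' \in undup (verts b).
  by rewrite mem_undup; apply: contraT => /hv; rewrite mx'.
have us := undup_uniq (verts b).
rewrite (bigD1_seq x vx us)/= big_mkcond/= (bigD1_seq x' vx' us)/= x'x big1.
  rewrite addr0 mx mx' /weight /= mul1r mulN1r -addrA lerD2l.
  have := lipA x x' cx cx'; rewrite ler_norml => /andP[_].
  rewrite (bigD1 i0)//= big1 => [|j /negPf ji]; last first.
    by rewrite updE ji subrr normr0.
  rewrite addr0 upd_same gtr0_norm ?subr_gt0// => H.
  have : x 0 i0 - e <= t by rewrite le_max lexx orbT.
  by lra.
by move=> v vx''; case: ifP => // vx0; apply: m0.
Qed.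

(* Shrinking a box that counts [x] positively to thickness [d] along the zero
   coordinates of [x] makes [B] at most [d] at all its vertices. *)
Lemma PM_ratios_zero x y i e : cube x -> x 0 i = 0 -> PM_ratios k A B x y ->
  0 < e -> exists2 z, PM_ratios k A B x z & (z <= e%:E)%E.
Proof.
move=> cx xi [bs [kbs m0] _] e0.
have [b bbs bx] : exists2 b, b \in bs & 0 < box_mult b x.
  apply/exists2P; apply: contrapT => H; move: m0; apply/negP; rewrite -leNgt.
  rewrite /mult big_seq sumr_le0// => b bbs.
  by rewrite leNgt; apply/negP => bx; apply: H; exists b.
have [c1 c2 b12 dimb] := kbs b bbs.
have /forallP xb : is_vertex b x by move: bx; rewrite /box_mult; case: ifP.
have b10 j : x 0 j = 0 -> b.1 0 j = 0.
  move=> xj; have /andP[b1 _] := c1 j; have := b12 j.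
  by have /orP[/eqP <-//|/eqP <-] := xb j; rewrite xj => ?; apply/le_anti/andP.
pose N := size (enum {ffun 'I_n -> bool}).
(* The box has at most [N] vertices, each contributing at most [d], so their sum stays below [e];
   the successor keeps the denominator positive. *)
pose d := e / N.+1%:R.
have d0 : 0 < d by rewrite divr_gt0.
pose b' : box R n :=
  (b.1, \row_j if x 0 j == 0 then Num.min (b.2 0 j) d else b.2 0 j).
(* Capping at [d > 0] keeps nondegenerate sides nondegenerate, so neither the dimension nor the
   multiplicity at [x] changes. *)
have min_gt0 u : (0 < Num.min u d) = (0 < u) by rewrite lt_min d0 andbT.
have kb' : is_kbox k b'.
  split=> //.
  - move=> j; rewrite mxE; case: eqP => // _; have /andP[b0 b1] := c2 j.
    by rewrite le_min b0 (ltW d0) ge_min b1.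
  - move=> j; rewrite mxE; case: eqP => // xj; have /andP[b0 b1] := c2 j.
    by rewrite b10// le_min b0 (ltW d0).
  - rewrite -dimb /box_dim; apply: eq_card => j; rewrite !inE mxE.
    by case: eqP => // xj; rewrite b10// min_gt0.
have b'x : box_mult b' x = box_mult b x.
  have [_ _ b12' _] := kb'; rewrite !box_mult_prod//; apply: eq_bigr => j _.
  rewrite mxE /=; case: eqP => // xj; rewrite /edge xj b10// min_gt0.
  suff -> : (0 == Num.min (b.2 0 j) d) = (0 == b.2 0 j) by [].
  have /andP[b0 _] := c2 j; move: (min_gt0 (b.2 0 j)).
  by rewrite !lt_neqAle b0 le_min b0 (ltW d0) !andbT => /negb_inj.
have kbs' : kbox_unions k [:: b'] by move=> c; rewrite inE => /eqP ->.
exists (L A B [:: b'] / `|mult [:: b'] x|%:~R)%:E.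
  by exists [:: b'] => //; split=> //; rewrite mult_seq1 b'x.
rewrite lee_fin mult_seq1 b'x gtr0_norm//.
have L0 := hL kbs'.
have z1 : (1 : R) <= (box_mult b x)%:~R by rewrite ler1z.
rewrite ler_pdivrMr ?(lt_le_trans ltr01)//.
apply: (@le_trans _ _ e); last by rewrite ler_peMr// ltW.
rewrite L_total mult_seq1 (totalE _ _ (@box_mult_verts _ _ b')).
(* A positive vertex contributes [B v <= v 0 i <= d], a negative one [- A v <= 0]. *)
apply: (@le_trans _ _ (\sum_(v <- undup (verts b')) d)).
  apply: ler_sum => v _.
  have [->|mv] := eqVneq (box_mult b' v) 0; first by rewrite weight0 ltW.
  have cv := kbox_cube kb' mv.
  have /forallP/(_ i) vb : is_vertex b' v.
    by move: mv; rewrite /box_mult; case: ifP.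
  have vd : v 0 i <= d.
    have /orP[/eqP ->|/eqP ->] := vb; first by rewrite /= b10// ltW.
    by rewrite mxE xi eqxx ge_min lexx orbT.
  have Bd : B v <= d by exact: le_trans (semicopula_le_coord i hB cv) vd.
  have A0 : 0 <= A v by case: hA => /(_ v cv)/andP[].
  rewrite /box_mult; case: ifP => _; last by rewrite weight0 ltW.
  rewrite /box_sign -signr_odd; case: (odd _); rewrite /weight /= ?mul1r//.
  by rewrite expr1 mulN1r (le_trans _ (ltW d0))// oppr_le0.
rewrite big_const_seq count_predT iter_addr_0 -mulr_natr.
have sN : (size (undup (verts b')) <= N.+1)%N.
  by rewrite (leq_trans (size_undup _))// size_map leqnSn.
rewrite (@le_trans _ _ (d * N.+1%:R))//; last by rewrite divfK// pnatr_eq0.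
by rewrite ler_pM2l// ler_nat.
Qed.

Lemma PM_of_inf : cond_ii -> cond_i.
Proof.
move=> h2 x cx; have [_ lipA] := quasicopula_of_inf h2.
have [/forallP x_gt0|] := boolP [forall i, 0 < x 0 i].
  rewrite /PM; case: asboolP => [e|_].
    have [y xy _] := PM_ratios_pos cx x_gt0 lipA ltr01.
    by rewrite e in xy.
  apply/le_anti/andP; split.
    apply/lee_addgt0Pr => e e0; apply: ge_ereal_inf.
    by have [y] := PM_ratios_pos cx x_gt0 lipA e0; exists y.
  by apply/ereal_infP => y; exact: PM_ratios_ge.
rewrite negb_forall => /existsP[i]; rewrite -leNgt => xi.
have {}xi : x 0 i = 0 by apply/le_anti; rewrite xi; have /andP[] := cx i.
have x0 : exists j, x 0 j = 0 by exists i.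
have AB0 : B x - A x = 0.
  by case: hA hB => [_ gA _ _] [_ gB _ _]; rewrite gA// gB// subrr.
(* On a zero face [B x - A x] is 0, which agrees with the default value when there are no ratios;
   otherwise the thin boxes apply. *)
rewrite /PM; case: asboolP => [_|/eqP/set0P[y xy]]; first by rewrite AB0.
apply/le_anti/andP; split.
  apply/lee_addgt0Pr => e e0; apply: ge_ereal_inf.
  by have [z] := PM_ratios_zero cx xi xy e0; rewrite AB0 add0e; exists z.
by apply/ereal_infP => z; exact: PM_ratios_ge.
Qed.

End Bounds.

Theorem theorem8p4 (R : realType) (n k : nat) (A B : 'rV[R]_n -> R)
    (hn : (0 < n)%N) (hk : (1 < k <= n)%N)
    (hA : semicopula A) (hB : semicopula B) (hAB : fle A B)
    (hL : forall bs : seq (box R n), kbox_unions k bs -> 0 <= L A B bs) :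
  let cond_i := forall x, cube x -> PM k A B x = (B x - A x)%:E in
  let cond_ii := forall x, cube x ->
    (A x)%:E = ereal_inf [set (C x)%:E | C in between_kinc_semicopulas k A B] in
  [/\ cond_i <-> cond_ii, cond_i -> quasicopula A & cond_ii -> quasicopula A].
Proof.
move=> cond_i cond_ii.
have i_ii : cond_i -> cond_ii := inf_of_PM hk hA hB hAB hL.
have ii_qc : cond_ii -> quasicopula A := quasicopula_of_inf hk hA.
split=> [|/i_ii/ii_qc//|//].
by split=> //; exact: PM_of_inf hk hA hB hL.
Qed.
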